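(* Let $k,n\in\mathbb{N}$ and $A\in\mathrm{Mat}_{kn,n}$. Then $$\operatorname{wrdet}_k(g\cdot A)=\chi_{n,k}(g)^k\operatorname{wrdet}_k A$$ for any $g\in\mathfrak{S}_k\wr\mathfrak{S}_n$. In other words, the line $\mathbb{C}\cdot\operatorname{wrdet}_k$ in the algebra of polynomial functions on $\mathrm{Mat}_{kn,n}(\mathbb{C})$ defines a one-dimensional representation of $\mathfrak{S}_k\wr\mathfrak{S}_n$.
   Context: $\mathrm{Mat}_{m,n}$ is the set of $m\times n$ matrices with entries in a commutative $\mathbb{C}$-algebra. $\mathfrak{S}_N$ is the symmetric group on $[N]=\{1,\dots,N\}$ and $\nu_N(w)$ is the number of cycles of $w\in\mathfrak{S}_N$ (fixed points included). For an $N\times N$ matrix $B=(b_{ij})$, $\det_k B:=\sum_{w\in\mathfrak{S}_N}(-\tfrac1k)^{N-\nu_N(w)}b_{w(1)1}\cdots b_{w(N)N}$. For a matrix $A$ with $n$ columns, $A^{[k]}$ is the matrix with $kn$ columns obtained by repeating each column of $A$ $k$ times consecutively, and for $A\in\mathrm{Mat}_{kn,n}$, $\operatorname{wrdet}_k A:=\det_k(A^{[k]})$. For $\sigma\in\mathfrak{S}_{kn}$ and $A=(a_{ij})\in\mathrm{Mat}_{kn,n}$, $\sigma\cdot A=(a_{\sigma^{-1}(i)j})_{i,j}$. Define injective homomorphisms $\phi:\mathfrak{S}_k^n\to\mathfrak{S}_{kn}$ and $\psi:\mathfrak{S}_n\to\mathfrak{S}_{kn}$ by $\phi(\sigma_1,\dots,\sigma_n):(i-1)k+j\mapsto(i-1)k+\sigma_i(j)$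 and $\psi(\tau):(i-1)k+j\mapsto(\tau(i)-1)k+j$ for $1\le i\le n$, $1\le j\le k$. Put $S_k^n=\phi(\mathfrak{S}_k^n)$, $S_n=\psi(\mathfrak{S}_n)$, and $\mathfrak{S}_k\wr\mathfrak{S}_n:=S_k^n\rtimes S_n\subset\mathfrak{S}_{kn}$. The character $\chi_{n,k}$ of $\mathfrak{S}_k\wr\mathfrak{S}_n$ is $\chi_{n,k}(g)=\operatorname{sgn}\tau$ for $g=\phi(\sigma_1,\dots,\sigma_n)\psi(\tau)$. *)

(* Defs.v *)
From HB Require Import structures.
From mathcomp Require Import all_boot all_order all_algebra all_fingroup.
From mathcomp Require Import all_character.
From mathcomp Require Import complex mpoly reals.

Set Implicit Arguments.
Unset Strict Implicit.
Unset Printing Implicit Defensive.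

Import GRing.Theory.
Local Open Scope ring_scope.

(* Indices are 0-based: the paper's (i-1)k+j, with 1 <= i <= n and 1 <= j <= k,
   becomes i * k + j with i : 'I_n and j : 'I_k. *)
Section Blocks.
Variables k n : nat.

Fact blk_subproof (i : 'I_n) (j : 'I_k) : (i * k + j < k * n)%N.
Proof.
rewrite (mulnC k); apply: (@leq_trans (i.+1 * k)).
  by rewrite mulSn addnC ltn_add2r.
by rewrite leq_mul2r ltn_ord orbT.
Qed.
Definition blk (i : 'I_n) (j : 'I_k) : 'I_(k * n) :=
  Ordinal (blk_subproof i j).

Fact blk_quo_subproof (x : 'I_(k * n)) : (x %/ k < n)%N.
Proof.
have k_gt0 : (0 < k)%N.
  by move: (leq_ltn_trans (leq0n x) (ltn_ord x)); rewrite muln_gt0 => /andP[].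
by rewrite ltn_divLR // [(n * k)%N]mulnC.
Qed.
Definition blk_quo (x : 'I_(k * n)) : 'I_n := Ordinal (blk_quo_subproof x).

Fact blk_rem_subproof (x : 'I_(k * n)) : (x %% k < k)%N.
Proof.
move: (leq_ltn_trans (leq0n x) (ltn_ord x)); rewrite muln_gt0 => /andP[k_gt0 _].
exact: ltn_pmod.
Qed.
Definition blk_rem (x : 'I_(k * n)) : 'I_k := Ordinal (blk_rem_subproof x).

Lemma blkK x : blk (blk_quo x) (blk_rem x) = x.
Proof. by apply: val_inj; rewrite /= -divn_eq. Qed.

Lemma blk_quoE i j : blk_quo (blk i j) = i.
Proof.
apply: val_inj => /=; have k_gt0 : (0 < k)%N by apply: leq_trans (ltn_ord j).
by rewrite divnMDl // divn_small // addn0.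
Qed.

Lemma blk_remE i j : blk_rem (blk i j) = j.
Proof. by apply: val_inj; rewrite /= modnMDl modn_small. Qed.

Lemma blk_phi_inj (s : {ffun 'I_n -> 'S_k}) :
  injective (fun x => blk (blk_quo x) (s (blk_quo x) (blk_rem x))).
Proof.
move=> x y eq_xy; have eq_quo : blk_quo x = blk_quo y.
  by have := congr1 blk_quo eq_xy; rewrite !blk_quoE.
have := congr1 blk_rem eq_xy; rewrite !blk_remE eq_quo => /perm_inj eq_rem.
by rewrite -(blkK x) -(blkK y) eq_quo eq_rem.
Qed.
Definition blk_phi (s : {ffun 'I_n -> 'S_k}) : 'S_(k * n) :=
  perm (@blk_phi_inj s).

Lemma blk_psi_inj (t : 'S_n) :
  injective (fun x => blk (t (blk_quo x)) (blk_rem x)).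
Proof.
move=> x y eq_xy.
have := congr1 blk_quo eq_xy; rewrite !blk_quoE => /perm_inj eq_quo.
have := congr1 blk_rem eq_xy; rewrite !blk_remE => eq_rem.
by rewrite -(blkK x) -(blkK y) eq_quo eq_rem.
Qed.
Definition blk_psi (t : 'S_n) : 'S_(k * n) := perm (@blk_psi_inj t).

Lemma blk_phiE s i j : blk_phi s (blk i j) = blk i (s i j).
Proof. by rewrite permE /= blk_quoE blk_remE. Qed.

Lemma blk_psiE t i j : blk_psi t (blk i j) = blk (t i) j.
Proof. by rewrite permE /= blk_quoE blk_remE. Qed.

Lemma eq_blk_perm (u v : 'S_(k * n)) :
  (forall i j, u (blk i j) = v (blk i j)) -> u = v.
Proof. by move=> eq_uv; apply/permP=> x; rewrite -(blkK x). Qed.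

Lemma blk_phiM s s' :
  (blk_phi s * blk_phi s')%g = blk_phi [ffun i => (s i * s' i)%g].
Proof.
by apply: eq_blk_perm => i j; rewrite permM !blk_phiE ffunE permM.
Qed.

Lemma blk_psiM t t' : (blk_psi t * blk_psi t')%g = blk_psi (t * t').
Proof. by apply: eq_blk_perm => i j; rewrite permM !blk_psiE permM. Qed.

Lemma blk_phi1 : blk_phi [ffun=> 1%g] = 1%g.
Proof. by apply: eq_blk_perm => i j; rewrite blk_phiE ffunE !perm1. Qed.

Lemma blk_psi1 : blk_psi 1 = 1%g.
Proof. by apply: eq_blk_perm => i j; rewrite blk_psiE !perm1. Qed.

Lemma blk_phi_is_inj : injective blk_phi.
Proof.
move=> s s' eq_s; apply/ffunP=> i; apply/permP=> j.
have /(congr1 blk_rem) := congr1 (fun u : 'S_(k * n) => u (blk i j)) eq_s.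
by rewrite /= !blk_phiE !blk_remE.
Qed.

Lemma blk_psi_is_inj : (0 < k)%N -> injective blk_psi.
Proof.
move=> k_gt0 t t' eq_t; apply/permP=> i; pose j := Ordinal k_gt0.
have /(congr1 blk_quo) := congr1 (fun u : 'S_(k * n) => u (blk i j)) eq_t.
by rewrite /= !blk_psiE !blk_quoE.
Qed.

Definition Skn : {set 'S_(k * n)} := [set blk_phi s | s : {ffun 'I_n -> 'S_k}].

Lemma Skn_group_set : group_set Skn.
Proof.
apply/group_setP; split; first by rewrite -blk_phi1 imset_f.
by move=> _ _ /imsetP[s _ ->] /imsetP[s' _ ->]; rewrite blk_phiM imset_f.
Qed.
Canonical Skn_group := Group Skn_group_set.

Definition Sn : {set 'S_(k * n)} := [set blk_psi t | t : 'S_n].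

Lemma Sn_group_set : group_set Sn.
Proof.
apply/group_setP; split; first by rewrite -blk_psi1 imset_f.
by move=> _ _ /imsetP[t _ ->] /imsetP[t' _ ->]; rewrite blk_psiM imset_f.
Qed.
Canonical Sn_group := Group Sn_group_set.

Definition wreath : {set 'S_(k * n)} := (Skn * Sn)%g.

Lemma blk_phiJ s t :
  ((blk_phi s) ^ (blk_psi t))%g = blk_phi [ffun i => s ((t^-1)%g i)].
Proof.
apply: (mulgI (blk_psi t)); rewrite -conjgC; apply: eq_blk_perm => i j.
by rewrite !permM blk_phiE !blk_psiE blk_phiE ffunE permK.
Qed.

Lemma Sn_norm_Skn : (Sn \subset 'N(Skn))%g.
Proof.
apply/subsetP=> _ /imsetP[t _ ->]; rewrite inE; apply/subsetP=> v /imsetP[u].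
by case/imsetP=> s _ -> ->; rewrite blk_phiJ imset_f.
Qed.

Lemma wreath_sdprod : (Skn ><| Sn)%g = wreath.
Proof.
apply: sdprodE Sn_norm_Skn _; apply/trivgP/subsetP=> x /setIP[].
case/imsetP=> s _ -> /imsetP[t _ eq_st].
have fix_t i (j : 'I_k) : i = t i.
  have := congr1 (fun u : 'S_(k * n) => blk_quo (u (blk i j))) eq_st.
  by rewrite /= blk_phiE blk_psiE !blk_quoE.
rewrite inE; apply/eqP/eq_blk_perm=> i j.
by rewrite perm1 eq_st blk_psiE -(fix_t i j).
Qed.

Lemma wreath_group_set : group_set wreath.
Proof.
by rewrite /wreath -(norm_joinEr Sn_norm_Skn) groupP.
Qed.
Canonical wreath_group := Group wreath_group_set.

(* Products of permutations are read left to right ((u * v) x = v (u x), permM),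
   so the paper's phi(s) psi(t) is blk_psi t * blk_phi s. *)
Definition chi (C : pzRingType) (g : 'S_(k * n)) : C :=
  if [pick st : {ffun 'I_n -> 'S_k} * 'S_n |
        g == (blk_psi st.2 * blk_phi st.1)%g] is Some st
  then (-1) ^+ st.2 else 0.

Lemma chiE (C : pzRingType) s t : (0 < k)%N ->
  chi C (blk_psi t * blk_phi s) = (-1) ^+ t.
Proof.
move=> k_gt0; rewrite /chi; case: pickP => [[s' t'] /= /eqP eq_g|/(_ (s, t))].
  suffices -> : t = t' by [].
  apply/permP=> i; pose j := Ordinal k_gt0.
  have := congr1 (fun u : 'S_(k * n) => blk_quo (u (blk i j))) eq_g.
  by rewrite /= !permM !blk_psiE !blk_phiE !blk_quoE.
by rewrite /= eqxx.
Qed.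

Lemma mem_wreathP (g : 'S_(k * n)) :
  reflect (exists s t, g = (blk_psi t * blk_phi s)%g) (g \in wreath).
Proof.
rewrite /wreath -(normC Sn_norm_Skn).
apply: (iffP mulsgP) => [[_ _ /imsetP[t _ ->] /imsetP[s _ ->] ->]|[s [t ->]]].
  by exists s, t.
by exists (blk_psi t) (blk_phi s); rewrite ?imset_f.
Qed.

End Blocks.

Arguments chi k n C g : clear implicits.

Section Wrdet.
Variables (C : fieldType) (S : comAlgType C).

Definition detk (k N : nat) (B : 'M[S]_N) : S :=
  \sum_(w : 'S_N)
    (- (k%:R^-1 : C)) ^+ (N - #|porbits w|) *: \prod_(i < N) B (w i) i.

Definition colrep (k m n : nat) (A : 'M[S]_(m, n)) : 'M[S]_(m, k * n) :=
  \matrix_(i, j) A i (blk_quo j).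

Definition wrdet (k n : nat) (A : 'M[S]_(k * n, n)) : S := detk k (colrep k A).

End Wrdet.

(* Entry (i, j) of perm_act g A is A (g^-1 i) j. *)
Definition perm_act (T : Type) (m n : nat) (g : 'S_m) (A : 'M[T]_(m, n)) :
  'M[T]_(m, n) := row_perm g^-1%g A.

Lemma perm_actM (T : Type) m n (g h : 'S_m) (A : 'M[T]_(m, n)) :
  perm_act (g * h)%g A = perm_act h (perm_act g A).
Proof. by rewrite /perm_act invMg row_permM. Qed.

Section PolynomialFunctions.
Variables (C : fieldType) (m n : nat).

Definition polyfun (f : 'M[C]_(m, n) -> C) : Prop :=
  exists p : {mpoly C[m * n]},
    forall A : 'M[C]_(m, n), f A = p.@[fun i => mxvec A 0 i].

Definition fun_act (g : 'S_m) (f : 'M[C]_(m, n) -> C) (A : 'M[C]_(m, n)) : C :=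
  f (perm_act g^-1%g A).

Lemma fun_actM (g h : 'S_m) f A :
  fun_act (g * h)%g f A = fun_act h (fun_act g f) A.
Proof. by rewrite /fun_act invMg perm_actM. Qed.

(* The line C.f is a one-dimensional subspace of the algebra of polynomial
   functions that is stable under G and on which G acts through rG: the
   coordinate c of c.f is sent to c%:M *m rG g, a right action like fun_act
   (see fun_actM). *)
Definition line_affords (G : {set 'S_m}) (f : 'M[C]_(m, n) -> C)
    (rG : mx_representation C G 1) : Prop :=
  [/\ polyfun f,
      exists A, f A != 0
    & forall g, g \in G -> forall (c : C) (A : 'M[C]_(m, n)),
        fun_act g (fun B => c * f B) A = (c%:M *m rG g) 0 0 * f A].

End PolynomialFunctions.

(* Main.v *)
Require Import Defs.
From mathcomp Require Import all_boot all_order all_algebra all_fingroup.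
From mathcomp Require Import all_character.
From mathcomp Require Import complex mpoly reals.

(** Everything rests on one property of [detk k]: it vanishes on matrices with
    [k.+1] equal columns ([detk_eq_cols]).  Each permutation [w] is weighted by
    [alpha ^+ (N - number of cycles of w)] with [alpha = - 1 / k].  If [k.+1]
    columns indexed by [P] agree, the sum over all permutations can be averaged
    over left translates by the symmetric group of [P].  When [w] has the
    points of [P] in distinct cycles, adding the points of [P] one at a time,
    each new point [a] multiplies the averaged weight by [1 + c * alpha], where
    [c] counts the earlier points: the transposition of [a] with each of these
    merges two cycles and contributes a factor [alpha].  The last factor is
    [1 + k * alpha = 0] ([cycle_weight_sum_perm_on]); a general [w] reduces to
    a separated one by a translation.

    Since every column of [A] is repeated [k] times in [colrep k A], adding a
    multiple of one column of [A] to another leaves [wrdet A] unchanged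
    ([wrdet_addcol]), whereas scaling a column by [c] multiplies it by
    [c ^+ k].  Exchanging two columns is three such additions and one change of
    sign, so permuting the columns by [t] multiplies [wrdet] by
    [((-1) ^+ t) ^+ k] ([wrdet_col_perm]).

    As [detk] is invariant under simultaneous permutations of rows and columns,
    an element of the wreath product acting on the rows of [A] may be moved to
    the columns of [colrep k A] ([colrep_perm_act]).  There the base group
    permutes equal columns, and [blk_psi t] permutes the columns of [A].

    For the line spanned by [wrdet] to be one-dimensional, [wrdet] must not be
    the zero function.  At the 0-1 matrix whose [j]-th column is the indicator
    of the [j]-th block of rows, it is the total weight of the Young subgroup
    of the blocks.  The merging argument computes this as well: all the factors
    are [1 - c / k] with [c < k], hence nonzero ([wrdet_blocks_neq0]). *)

Set Implicit Arguments.
Unset Strict Implicit.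
Unset Printing Implicit Defensive.

Import GRing.Theory Num.Theory.
Local Open Scope ring_scope.

(** * Sums of cycle weights over Young subgroups *)

Section CycleSums.
Variables (T : finType) (C : comNzRingType) (alpha : C).

Definition cycle_weight (w : {perm T}) : C := alpha ^+ (#|T| - #|porbits w|).

Lemma card_porbits_le (w : {perm T}) : (#|porbits w| <= #|T|)%N.
Proof. exact: leq_imset_card. Qed.

Lemma cycle_weight_tperm (w : {perm T}) a b : a != b -> a \notin porbit w b ->
  cycle_weight (tperm a b * w) = alpha * cycle_weight w.
Proof.
move=> neq_ab sep_ab; have := porbits_mul_tperm w a b.
rewrite neq_ab sep_ab /= addn2 addn1 => -[card_w].
by rewrite /cycle_weight -exprS -subSn ?card_porbits_le // -card_w subSS.
Qed.

(** Points that lie in distinct cycles of [w]: the situation in which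
    multiplying by transpositions of points of [Q] always merges cycles. *)
Definition separates (w : {perm T}) (Q : {set T}) :=
  {in Q &, forall x y, x \in porbit w y -> x = y}.

(** Take the translate with the most cycles: if two points of [Q] still shared a
    cycle, their transposition would split it into two. *)
Lemma separates_translate (w : {perm T}) (Q : {set T}) :
  exists2 r : {perm T}, perm_on Q r & separates (r * w)%g Q.
Proof.
have on1 : perm_on Q (1 : {perm T})%g by apply: perm_on1.
case: (arg_maxnP (fun r : {perm T} => #|porbits (r * w)|) on1).
move=> r on_r max_r; exists r => // x y Qx Qy xy; apply/eqP/negPn/negP=> neq_xy.
have on_t : perm_on Q (tperm x y * r)%g.
  apply: perm_onM => //; apply: subset_trans (tperm_on x y) _.
  by apply/subsetP=> z /set2P[] ->.
have := porbits_mul_tperm (r * w)%g x y.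
rewrite xy neq_xy /= addn0 mulgA => card_t.
by have := max_r _ on_t; rewrite /= card_t addn1 ltnn.
Qed.

Section Young.
Variables (L : eqType) (q : T -> L).

Definition young (Q : {set T}) : {set {perm T}} :=
  [set s | perm_on Q s && [forall x, q (s x) == q x]].

Lemma youngP (Q : {set T}) (s : {perm T}) :
  reflect (perm_on Q s /\ forall x, q (s x) = q x) (s \in young Q).
Proof.
rewrite inE; apply: (iffP andP) => [[on_s /forallP q_s]|[on_s q_s]].
  by split=> // x; apply/eqP.
by split=> //; apply/forallP=> x; rewrite q_s.
Qed.

Lemma young0 : young set0 = [set 1%g].
Proof.
apply/setP=> s; rewrite inE [RHS]inE; apply/andP/eqP=> [[on_s _]|->].
  by apply: perm_on_id on_s _; rewrite cards0.
by split; [apply: perm_on1 | apply/forallP=> x; rewrite perm1].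
Qed.

Lemma young_mul (Q : {set T}) (s t : {perm T}) :
  s \in young Q -> t \in young Q -> (s * t)%g \in young Q.
Proof.
move=> /youngP[on_s q_s] /youngP[on_t q_t]; apply/youngP.
by split=> [|x]; [apply: perm_onM | rewrite permM q_t q_s].
Qed.

Lemma young_tperm (Q : {set T}) a b :
  a \in Q -> b \in Q -> q b = q a -> tperm a b \in young Q.
Proof.
move=> Qa Qb q_ab; apply/youngP; split=> [|x]; last by case: tpermP => // ->.
by apply: subset_trans (tperm_on a b) _; apply/subsetP=> z /set2P[] ->.
Qed.

(** Coset decomposition: the elements of [young (a |: Q)] that send [b] to [a]
    form the coset of [tperm a b] over [young Q], the stabiliser of [a]. *)
Lemma young_sum_setU1 (G : {perm T} -> C) (Q : {set T}) a : a \notin Q ->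
  \sum_(s in young (a |: Q)) G s =
  \sum_(b in a |: Q | q b == q a) \sum_(s in young Q) G (tperm a b * s)%g.
Proof.
move=> notQa.
rewrite (partition_big (fun s : {perm T} => (s^-1)%g a)
           (fun b => (b \in a |: Q) && (q b == q a))) /=; last first.
  move=> s /youngP[on_s q_s]; rewrite (perm_closed _ (perm_onV on_s)) setU11 /=.
  by rewrite -{2}(permKV s a) q_s.
apply: eq_bigr => b /andP[Qb /eqP q_b].
rewrite (reindex_inj (mulgI (tperm a b))) /=; apply: eq_bigl => s.
have Yt : tperm a b \in young (a |: Q) by apply: young_tperm; rewrite ?setU11.
rewrite (canF_eq (permKV _)) permM tpermR.
apply/andP/idP=> [[Yts /eqP fix_a]|Ys].
  have := young_mul Yt Yts; rewrite mulgA tperm2 mul1g.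
  case/youngP=> on_s q_s; apply/youngP; split=> //.
  apply/subsetP=> x moved_x; have := subsetP on_s x moved_x.
  by case/setU1P=> // x_a; move: moved_x; rewrite x_a inE -fix_a eqxx.
have [on_s q_s] := youngP _ _ Ys; split; last by rewrite (out_perm on_s).
apply: young_mul => //; apply/youngP; split=> //.
by apply: subset_trans on_s _; apply: subsetUr.
Qed.

(** The coset of [tperm a a = 1] contributes the sum over [young Q] itself, and
    each of the other cosets contributes [alpha] times that sum, because
    [tperm a b] merges the cycles of [a] and [b]. *)
Lemma young_weight_setU1 (w : {perm T}) (Q : {set T}) a :
    a \notin Q -> separates w (a |: Q) ->
  \sum_(s in young (a |: Q)) cycle_weight (s * w)%g =
  (1 + alpha *+ #|[set b in Q | q b == q a]|) *
    \sum_(s in young Q) cycle_weight (s * w)%g.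
Proof.
move=> notQa sep_w; rewrite young_sum_setU1 //.
rewrite (bigD1 a) ?setU11 ?eqxx //= mulrDl mul1r; congr (_ + _).
  by apply: eq_bigr => s _; rewrite tperm1 mul1g.
rewrite (eq_bigl (fun b => b \in [set b in Q | q b == q a])) => [|b]; last first.
  rewrite in_setU1 inE; have [->|_] := eqVneq b a; last by rewrite andbT.
  by rewrite andbF (negPf notQa).
rewrite mulrnAl -sumr_const; apply: eq_bigr => b; rewrite inE => /andP[Qb _].
rewrite mulr_sumr; apply: eq_bigr => s /youngP[on_s _]; rewrite -mulgA.
apply: cycle_weight_tperm; first by apply: contraNneq notQa => ->.
(* The union of the cycles of [w] through [Q] is stable under [s * w] and avoids
   [a], so multiplying [w] by [s] does not bring [a] into the cycle of [b]. *)
pose O := \bigcup_(c in Q) porbit w c.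
have O_stable x : x \in O -> (s * w)%g x \in O.
  have O_w y : y \in O -> w y \in O.
    case/bigcupP=> c Qc cy; apply/bigcupP; exists c => //.
    by move: cy; rewrite -!eq_porbit_mem (porbit_perm w 1).
  rewrite permM => Ox; apply: O_w; have [Qx|notQx] := boolP (x \in Q).
    apply/bigcupP; exists (s x); last exact: porbit_id.
    by rewrite (perm_closed _ on_s).
  by rewrite (out_perm on_s).
have O_iter i : (((s * w) ^+ i) b)%g \in O.
  elim: i => [|i IHi]; last by rewrite expgSr permM O_stable.
  by rewrite expg0 perm1; apply/bigcupP; exists b => //; apply: porbit_id.
apply/negP=> /porbitP[i a_i]; have := O_iter i; rewrite -a_i.
case/bigcupP=> c Qc /sep_w a_c; move: notQa; rewrite a_c ?Qc ?setU11 //.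
by rewrite setU1r.
Qed.

End Young.

(** The sum is a multiple of [\prod_(c < k.+1) (1 + c * alpha)], and its factor
    at [c = k] is zero. *)
Lemma cycle_weight_sum_perm_on (k : nat) (P : {set T}) (w : {perm T}) :
    1 + alpha *+ k = 0 -> #|P| = k.+1 ->
  \sum_(s : {perm T} | perm_on P s) cycle_weight (s * w)%g = 0.
Proof.
move=> root_k card_P; have [r on_r sep_r] := separates_translate w P.
rewrite (reindex_inj (mulIg r)) /=.
(* With a constant labelling, the Young subgroup is the full symmetric group. *)
pose q := fun _ : T => tt.
rewrite (eq_bigl (fun s => s \in young q P)) => [|s]; last first.
  apply/idP/youngP=> [on_sr|[on_s _]]; last exact: perm_onM.
  by split=> //; have := perm_onM on_sr (perm_onV on_r); rewrite mulgK.
have /card_gt0P[a Pa] : (0 < #|P|)%N by rewrite card_P.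
under eq_bigr do rewrite -mulgA.
have notPa : a \notin P :\ a by rewrite !inE eqxx.
rewrite -(setD1K Pa) young_weight_setU1 ?setD1K //.
rewrite (eq_card (B := P :\ a)) => [|b]; last by rewrite inE eqxx andbT.
by move: card_P; rewrite (cardsD1 a) Pa add1n => -[->]; rewrite root_k mul0r.
Qed.

Lemma porbit_conj (w g : {perm T}) x : porbit (w ^ g)%g (g x) = g @: porbit w x.
Proof.
apply/setP=> y; apply/porbitP/imsetP=> [[i ->]|[z /porbitP[i ->] ->]].
  by exists (((w ^+ i) x)%g); rewrite ?mem_porbit // -conjXg permJ.
by exists i; rewrite -conjXg permJ.
Qed.

Lemma cycle_weight_conj (w g : {perm T}) :
  cycle_weight (w ^ g)%g = cycle_weight w.
Proof.
congr (_ ^+ (_ - _)).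
rewrite -(card_imset (porbits w) (imset_inj (@perm_inj _ g))).
apply: eq_card => O; apply/imsetP/imsetP=> [[y _ ->]|[_ /imsetP[x _ ->] ->]].
  exists (porbit w (g^-1 y)%g); first exact: imset_f.
  by rewrite -porbit_conj permKV.
by exists (g x); rewrite ?porbit_conj.
Qed.

End CycleSums.

(** * The alpha-determinant at alpha = - 1 / k *)

Section DetK.
Variables (C : numFieldType) (S : comAlgType C) (k N : nat).
Implicit Types B : 'M[S]_N.

Lemma detkE B :
  detk k B = \sum_w cycle_weight (- k%:R^-1) w *: \prod_(i < N) B (w i) i.
Proof. by apply: eq_bigr => w _; rewrite /cycle_weight card_ord. Qed.

Lemma detk_conj (g : 'S_N) B : detk k (row_perm g (col_perm g B)) = detk k B.
Proof.
rewrite !detkE (reindex_inj (conjg_inj g^-1%g)) /=; apply: eq_bigr => w _.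
rewrite cycle_weight_conj; congr (_ *: _).
rewrite (reindex_inj (@perm_inj _ (g^-1)%g)) /=; apply: eq_bigr => i _.
by rewrite !mxE permJ !permKV.
Qed.

Lemma detk_multilinear B B1 B2 (x : 'I_N) (c : C) :
    (forall r, B r x = B1 r x + c *: B2 r x) ->
    (forall r y, y != x -> B1 r y = B r y) ->
    (forall r y, y != x -> B2 r y = B r y) ->
  detk k B = detk k B1 + c *: detk k B2.
Proof.
move=> B_x B1_y B2_y; rewrite scaler_sumr -big_split /=; apply: eq_bigr => w _.
rewrite !(bigD1 x (P := xpredT)) //= B_x mulrDl scalerDr scalerAl -!scalerAl.
rewrite !scalerA [in RHS](mulrC c) -!scalerA.
by congr (_ *: (_ * _) + _ *: (_ *: (_ * _)));
  apply: eq_bigr => y neq_yx; rewrite ?B1_y ?B2_y.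
Qed.

(** Permuting the equal columns shows that [w] may be replaced by [s * w] in the
    weight for any [s] supported on [P]; summing over all such [s] gives zero,
    and the number of them is invertible in characteristic 0. *)
Lemma detk_eq_cols B (P : {set 'I_N}) :
    (0 < k)%N -> #|P| = k.+1 -> (forall r, {in P &, forall x y, B r x = B r y}) ->
  detk k B = 0.
Proof.
move=> k_gt0 card_P eq_P.
have detk_shift (s : 'S_N) : perm_on P s -> detk k B =
    \sum_w cycle_weight (- k%:R^-1) (s * w)%g *: \prod_(i < N) B (w i) i.
  move=> on_s; rewrite detkE (reindex_inj (mulgI s)); apply: eq_bigr => w _ /=.
  congr (_ *: _); rewrite [RHS](reindex_inj (@perm_inj _ s)) /=.
  apply: eq_bigr => i _; rewrite permM; have [Pi|notPi] := boolP (i \in P).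
    by apply: eq_P => //; rewrite (perm_closed _ on_s).
  by rewrite (out_perm on_s).
have alpha_root : 1 + (- k%:R^-1 : C) *+ k = 0.
  by rewrite mulNrn -(mulr_natr _^-1) mulVf ?subrr // pnatr_eq0 -lt0n.
have : detk k B *+ #|[set s : 'S_N | perm_on P s]| = 0.
  rewrite -sumr_const (eq_bigr (fun s : 'S_N =>
    \sum_w cycle_weight (- k%:R^-1) (s * w)%g *: \prod_(i < N) B (w i) i)).
    rewrite exchange_big /= big1 // => w _; rewrite -scaler_suml.
    rewrite (eq_bigl (fun s => perm_on P s)) => [|s]; last by rewrite inE.
    by rewrite (cycle_weight_sum_perm_on _ alpha_root card_P) scale0r.
  by move=> s; rewrite inE => /detk_shift.
rewrite -scaler_nat => /(congr1 (fun d => #|[set s : 'S_N | perm_on P s]|%:R^-1 *: d)).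
rewrite scaler0 scalerA mulVf ?scale1r // pnatr_eq0 -lt0n.
by apply/card_gt0P; exists 1%g; rewrite inE perm_on1.
Qed.

End DetK.

(** * Column operations on the wreath determinant *)

Section Columns.
Variables (C : numFieldType) (S : comAlgType C) (k n : nat).
Hypothesis k_gt0 : (0 < k)%N.
Implicit Types A : 'M[S]_(k * n, n).

Definition block (j : 'I_n) : {set 'I_(k * n)} := [set x | blk_quo x == j].

Lemma card_block j : #|block j| = k.
Proof.
have blk_inj : injective (@blk k n j).
  by move=> y z /(congr1 (@blk_rem k n)); rewrite !blk_remE.
rewrite -[RHS]card_ord -(card_imset _ blk_inj).
apply: eq_card => x; rewrite inE; apply/eqP/imsetP=> [<-|[y _ ->]].
  by exists (blk_rem x); rewrite ?blkK.
by rewrite blk_quoE.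
Qed.

(** The [k] copies of column [i] can be modified one at a time.  By linearity
    each modification adds a multiple of [detk] of a matrix in which column [j]
    occurs [k.+1] times: in its own block and at the modified position. *)
Lemma wrdet_addcol A A' (i j : 'I_n) (c : C) : i != j ->
    (forall r, A' r i = A r i + c *: A r j) ->
    (forall r l, l != i -> A' r l = A r l) ->
  wrdet A' = wrdet A.
Proof.
move=> neq_ij A'_i A'_l.
(* [M X] is [colrep k A] with only the copies indexed by [X] modified. *)
pose M (X : {set 'I_(k * n)}) : 'M[S]_(k * n) :=
  \matrix_(r, x) (A r (blk_quo x) + if x \in X then c *: A r j else 0).
have detM (X : {set 'I_(k * n)}) : X \subset block i -> detk k (M X) = wrdet A.
  have [m] := ubnP #|X|; elim: m X => // m IHm X leXm sX_i.
  have [->|[x Xx]] := set_0Vmem X.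
    congr (detk k _); apply/matrixP=> r y.
    by rewrite !mxE in_set0 addr0.
  have /IHm <- : (#|X :\ x| < m)%N by move: leXm; rewrite (cardsD1 x) Xx.
    pose M2 : 'M[S]_(k * n) := \matrix_(r, y) if y == x then A r j else M X r y.
    have x_i : blk_quo x = i by have := subsetP sX_i x Xx; rewrite inE => /eqP.
    rewrite (@detk_multilinear _ _ _ _ _ (M (X :\ x)) M2 x c).
    - rewrite (@detk_eq_cols _ _ _ _ M2 (x |: block j)) ?scaler0 ?addr0 //.
        by rewrite cardsU1 card_block inE x_i neq_ij.
      move=> r; suff M2_j : {in x |: block j, forall y, M2 r y = A r j}.
        by move=> y z Py Pz; rewrite !M2_j.
      move=> y; rewrite !inE mxE; case: eqP => //= _ /eqP y_j.
      rewrite mxE y_j; case: ifP => [Xy|_]; last by rewrite addr0.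
      by have := subsetP sX_i y Xy; rewrite inE y_j eq_sym (negPf neq_ij).
    - by move=> r; rewrite !mxE !inE !eqxx /= addr0 Xx.
    - by move=> r y neq_yx; rewrite !mxE !inE neq_yx.
    - by move=> r y neq_yx; rewrite !mxE (negPf neq_yx).
  exact: subset_trans (subsetDl _ _) sX_i.
rewrite -(detM _ (subxx _)); congr (detk k _); apply/matrixP=> r y.
by rewrite !mxE inE; case: eqP => [->|/eqP/A'_l->] //; rewrite addr0.
Qed.

Lemma wrdet_scalecol A A' (i : 'I_n) (c : C) :
    (forall r, A' r i = c *: A r i) ->
    (forall r l, l != i -> A' r l = A r l) ->
  wrdet A' = c ^+ k *: wrdet A.
Proof.
move=> A'_i A'_l; rewrite scaler_sumr; apply: eq_bigr => w _.
rewrite scalerA mulrC -scalerA; congr (_ *: _).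
rewrite (eq_bigr (fun x => (if x \in block i then c else 1) *:
                            colrep k A (w x) x)) => [|x _]; last first.
  rewrite !mxE inE; case: eqP => [->|/eqP/A'_l->] //; last by rewrite scale1r.
by rewrite scaler_prod -big_mkcond prodr_const card_block.
Qed.

(** The pair of columns (a, b) goes to (a, b + a), (- b, b + a) and (- b, a) by
    additions, and then to (b, a) by a change of sign. *)
Lemma wrdet_xcol A (i j : 'I_n) : i != j -> wrdet (xcol i j A) = (-1) ^+ k *: wrdet A.
Proof.
move=> neq_ij; have neq_ji : j != i by rewrite eq_sym.
pose upd A' l (v : 'I_(k * n) -> S) : 'M[S]_(k * n, n) :=
  \matrix_(r, l') if l' == l then v r else A' r l'.
pose A1 := upd A j (fun r => A r j + A r i).
pose A2 := upd A1 i (fun r => - A r j).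
pose A3 := upd A2 j (fun r => A r i).
have -> : wrdet (xcol i j A) = (-1) ^+ k *: wrdet A3.
  apply: (@wrdet_scalecol _ _ i) => [r|r l neq_li]; rewrite !mxE.
    by rewrite tpermL !eqxx (negPf neq_ij) scaleN1r opprK.
  case: eqP => [->|/eqP neq_lj]; first by rewrite tpermR.
  by rewrite (negPf neq_li) tpermD // eq_sym.
congr (_ *: _).
transitivity (wrdet A2).
  apply: (@wrdet_addcol _ _ j i 1) => // [r|r l neq_lj]; rewrite !mxE.
    by rewrite !eqxx (negPf neq_ji) scale1r addrAC subrr add0r.
  by rewrite (negPf neq_lj).
transitivity (wrdet A1).
  apply: (@wrdet_addcol _ _ i j (-1)) => // [r|r l neq_li]; rewrite !mxE.
    by rewrite !eqxx (negPf neq_ij) scaleN1r opprD addrCA subrr addr0.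
  by rewrite (negPf neq_li).
apply: (@wrdet_addcol _ _ j i 1) => // [r|r l neq_lj]; rewrite !mxE.
  by rewrite !eqxx scale1r.
by rewrite (negPf neq_lj).
Qed.

Lemma wrdet_col_perm A (t : 'S_n) :
  wrdet (col_perm t A) = ((-1) ^+ t) ^+ k *: wrdet A.
Proof.
have [ts -> dp_ts] := prod_tpermP t; elim: ts dp_ts => [|ij ts IHts] /=.
  by rewrite big_nil odd_perm1 expr0 expr1n scale1r col_perm1.
case/andP=> neq_ij /IHts {IHts}; rewrite big_cons.
set u := (\prod_(_ <- ts) _)%g => IHts.
rewrite col_permM wrdet_xcol // IHts.
by rewrite odd_mul_tperm neq_ij signr_addb exprMn scalerA.
Qed.

(** * The action of the wreath product *)

(** Conjugation invariance turns a row permutation of [colrep k A] into the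
    inverse permutation of its columns. *)
Lemma colrep_perm_act A (g : 'S_(k * n)) :
  detk k (colrep k (perm_act g A)) = detk k (col_perm g (colrep k A)).
Proof.
rewrite -[RHS](detk_conj _ g^-1%g); congr (detk k _).
by apply/matrixP=> r x; rewrite !mxE permKV.
Qed.

Lemma wrdet_phi A s : wrdet (perm_act (blk_phi s) A) = wrdet A.
Proof.
rewrite /wrdet colrep_perm_act; congr (detk k _); apply/matrixP=> r x.
by rewrite !mxE -{1}(blkK x) blk_phiE blk_quoE.
Qed.

Lemma wrdet_psi A t :
  wrdet (perm_act (blk_psi k t) A) = ((-1) ^+ t) ^+ k *: wrdet A.
Proof.
rewrite -wrdet_col_perm /wrdet colrep_perm_act; congr (detk k _).
by apply/matrixP=> r x; rewrite !mxE -{1}(blkK x) blk_psiE blk_quoE.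
Qed.

Lemma wrdet_wreath A (g : 'S_(k * n)) : g \in wreath k n ->
  wrdet (perm_act g A) = chi k n C g ^+ k *: wrdet A.
Proof.
case/mem_wreathP=> s [t ->].
by rewrite perm_actM wrdet_phi wrdet_psi chiE.
Qed.

End Columns.

(** * The character of the wreath product *)

Section Character.
Variables (k n : nat) (C : pzRingType).
Hypothesis k_gt0 : (0 < k)%N.

Lemma chi1 : chi k n C 1 = 1.
Proof.
rewrite -[1%g in LHS]mulg1 -{1}(blk_psi1 k n) -(blk_phi1 k n).
by rewrite chiE // odd_perm1.
Qed.

Lemma chiM : {in wreath k n &, {morph chi k n C : g h / (g * h)%g >-> g * h}}.
Proof.
move=> _ _ /mem_wreathP[s [t ->]] /mem_wreathP[s' [t' ->]].
rewrite -mulgA (mulgA (blk_phi s)) (conjgC (blk_phi s)) blk_phiJ -mulgA blk_phiM mulgA.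
by rewrite blk_psiM !chiE // odd_permM signr_addb.
Qed.

(** The values of [chi] are signs, hence their own inverses. *)
Lemma chiV g : g \in wreath k n -> chi k n C g^-1%g = chi k n C g.
Proof.
move=> Wg; have sgn_g : chi k n C g * chi k n C g = 1.
  by case/mem_wreathP: Wg => s [t ->]; rewrite chiE // -signr_addb addbb.
rewrite -[LHS]mulr1 -sgn_g mulrA -chiM ?groupV //.
by rewrite mulVg chi1 mul1r.
Qed.

End Character.

(** * The wreath determinant is a nonzero polynomial function *)

Section NonVanishing.
Variables (C : numFieldType) (k : nat).
Hypothesis k_gt0 : (0 < k)%N.

(** Building up [Q] point by point gives a product of factors [1 - c / k], where
    [c] counts the points already present with the label of the new one. *)
Lemma young_weight_neq0 (T : finType) (L : eqType) (q : T -> L) (Q : {set T}) :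
    (forall l, #|[set x in Q | q x == l]| <= k)%N ->
  \sum_(s in young q Q) cycle_weight (- k%:R^-1 : C) s != 0.
Proof.
have [m] := ubnP #|Q|; elim: m Q => // m IHm Q le_Qm small_Q.
have [->|[a Qa]] := set_0Vmem Q.
  rewrite young0 big_set1 /cycle_weight expf_neq0 // oppr_eq0 invr_eq0.
  by rewrite pnatr_eq0 -lt0n.
have notQa : a \notin Q :\ a by rewrite !inE eqxx.
have sep1 : separates (1 : {perm T}) Q.
  by move=> x y _ _ /porbitP[i ->]; rewrite expg1n perm1.
under eq_bigr do rewrite -[X in cycle_weight _ X]mulg1.
have lt_ak : (#|[set b in Q :\ a | q b == q a]| < k)%N.
  apply: leq_trans (small_Q (q a)).
  rewrite [X in (_ < X)%N](cardsD1 a) inE Qa eqxx add1n ltnS.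
  by apply/subset_leq_card/subsetP=> x; rewrite !inE andbA.
rewrite -(setD1K Qa) young_weight_setU1 ?setD1K // mulf_neq0 //.
  rewrite mulNrn subr_eq0; apply: contraTneq lt_ak => one_eq.
  have k_neq0 : k%:R != 0 :> C by rewrite pnatr_eq0 -lt0n.
  move: one_eq; rewrite -(mulr_natr _^-1) => /(congr1 ( *%R k%:R)).
  by rewrite mulr1 mulVKf // => /eqP; rewrite eqr_nat => /eqP <-; rewrite ltnn.
under eq_bigr do rewrite mulg1.
apply: IHm => [|l]; first by move: le_Qm; rewrite (cardsD1 a) Qa.
apply: leq_trans (small_Q l); apply/subset_leq_card/subsetP=> x.
by rewrite !inE -andbA => /andP[].
Qed.

(** The entries of this matrix are such that only the permutations preserving
    every block contribute, each with its weight. *)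
Lemma wrdet_blocks_neq0 n :
  wrdet (\matrix_(x < k * n, j < n) (blk_quo x == j)%:R : 'M[C^o]_(_, _)) != 0.
Proof.
suff -> : wrdet (\matrix_(x < k * n, j < n) (blk_quo x == j)%:R : 'M[C^o]_(_, _))
    = \sum_(s in young (@blk_quo k n) setT) cycle_weight (- k%:R^-1 : C) s.
  apply: young_weight_neq0 => l; rewrite -[X in (_ <= X)%N](card_block k l).
  by apply/subset_leq_card/subsetP=> x; rewrite !inE.
rewrite /wrdet detkE [RHS]big_mkcond; apply: eq_bigr => w _ /=.
case: youngP => [[_ w_q]|not_w].
  by rewrite big1 ?[_ *: _]mulr1 // => x _; rewrite !mxE w_q eqxx.
have [x neq_x] : exists x, blk_quo (w x) != blk_quo x.
  apply/existsP; apply: contra_notT not_w => /existsPn w_q.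
  by split=> [|x]; [apply/subsetP=> x; rewrite !inE | apply/eqP/negPn/w_q].
by rewrite (bigD1 x) //= !mxE (negPf neq_x) mul0r scaler0.
Qed.

End NonVanishing.

(** The polynomial is the wreath determinant of the generic matrix, evaluated
    through the algebra morphism [meval]. *)
Lemma wrdet_polyfun (C : fieldType) k n :
  polyfun (fun A : 'M[C]_(k * n, n) => wrdet (S := C^o) A).
Proof.
pose X : 'M[{mpoly C[k * n * n]}]_(k * n, n) :=
  \matrix_(i, j) mpolyX C U_(mxvec_index i j).
exists (wrdet X) => A; rewrite /wrdet /detk rmorph_sum /=; apply: eq_bigr => w _.
rewrite mevalZ rmorph_prod; congr (_ * _); apply: eq_bigr => i _.
by rewrite !mxE /= mevalXU mxvecE.
Qed.

(** * The representation afforded by the wreath determinant *)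

Unset Implicit Arguments.
Set Strict Implicit.
Set Printing Implicit Defensive.

Theorem lemma4p7 (R : realType) (k n : nat) (hk : (0 < k)%N) (hn : (0 < n)%N) :
  (forall (S : comAlgType R[i]) (A : 'M[S]_(k * n, n)) (g : 'S_(k * n)),
      g \in wreath k n ->
      wrdet (perm_act g A) = (chi k n R[i] g) ^+ k *: wrdet A) /\
  (exists rG : mx_representation R[i] (wreath k n) 1,
      (forall g : 'S_(k * n), g \in wreath k n ->
         rG g = ((chi k n R[i] g) ^+ k)%:M) /\
      line_affords (C := R[i])
        (fun A : 'M[R[i]]_(k * n, n) => wrdet (S := R[i]^o) A) rG).
Proof.
have equivariant (S : comAlgType R[i]) (A : 'M[S]_(k * n, n)) (g : 'S_(k * n)) :
    g \in wreath k n ->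
    wrdet (perm_act g A) = (chi k n R[i] g) ^+ k *: wrdet A.
  exact: wrdet_wreath.
split=> //.
have chi_repr : mx_repr (wreath k n) (fun g => ((chi k n R[i] g) ^+ k)%:M : 'M_1).
  split=> [|g h Wg Wh]; first by rewrite chi1 // expr1n.
  by rewrite chiM // exprMn scalar_mxM.
exists (MxRepresentation chi_repr); split; first by move=> g _.
split.
- exact: wrdet_polyfun.
- by eexists; apply: wrdet_blocks_neq0.
move=> g Wg c A; rewrite /fun_act /= equivariant ?groupV // chiV //.
by rewrite -scalar_mxM mxE eqxx mulr1n -mulrA.
Qed.
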